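(* Let $G$ be a finite group, $S\subset G$ with $e\notin S$, and consider $\Gamma^*=X^*(G,S)$ and $\Gamma^*_{S\cup e}=MX^*(G;S,S\cup\{e\})$. If $Spec(\Gamma^* )\subset\mathbb{R}$, then: (a) $\Gamma^*_{S\cup e}$ is not hypoenergetic. (b) If $\Gamma^*$ is orderenergetic, then $\Gamma^*_{S\cup e}$ is not orderenergetic. (c) If $\Gamma^*$ is hyperenergetic, then $\Gamma^*_{S\cup e}$ is hyperenergetic.
   Context: $X(G,S)$ is the Cayley graph with vertex set $G$ and a directed edge from $h$ to $g$ iff $gh^{-1}\in S$; $X^+(G,S)$ is the Cayley sum graph with vertex set $G$ and a directed edge from $h$ to $g$ iff $gh\in S$ (loops allowed). $X^*(G,S)$ denotes either one; a statement with $*$ is asserted for both choices, the same choice being made throughout. If $A$ is the adjacency matrix of $\Gamma^*$, then $\Gamma^*_{S\cup e}=MX^*(G;S,S\cup\{e\})=\Gamma^*\boxtimes P_2$ (strong product with the 2-path $P_2$) is the graph with vertex set $G\times\mathbb{Z}_2$ and adjacency matrix $\begin{pmatrix}A&A+I\\ A+I&A\end{pmatrix}$. $Spec$ is the multiset of complex eigenvalues of the adjacency matrix counted with (algebraic) multiplicity, and the energy is $\mathcal{E}(\Gamma)=\sum_{\lambda\in Spec(\Gamma)}|\lambda|$. A graph $\Gamma$ with $n$ vertices is hypoenergetic if $\mathcal{E}(\Gamma)<n$, orderenergetic if $\mathcal{E}(\Gamma)=n$, and hyperenergetic if $\mathcal{E}(\Gamma)>2n-2$. *)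

(* Defs.v *)
From mathcomp Require Import all_boot all_order all_fingroup all_algebra.
From mathcomp Require Import reals complex.

Set Implicit Arguments.
Unset Strict Implicit.
Unset Printing Implicit Defensive.

Import Order.TTheory GRing.Theory Num.Theory.
Local Open Scope ring_scope.

(* [Γ u v] is the number of edges from [u] to [v].  Multiplicities are needed
   because [A + I] has an entry 2 at every loop of [Γ], and Cayley sum graphs
   may have loops. *)
Definition multidigraph (T : finType) := T -> T -> nat.

Definition cayley_graph (gT : finGroupType) (S : {set gT}) : multidigraph gT :=
  fun h g => ((g * h^-1)%g \in S) : nat.

Definition cayley_sum_graph (gT : finGroupType) (S : {set gT}) :
    multidigraph gT :=
  fun h g => ((g * h)%g \in S) : nat.

Variant cayley_kind := Cayley | CayleySum.

Definition cayley_star (k : cayley_kind) (gT : finGroupType) (S : {set gT}) :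
    multidigraph gT :=
  match k with
  | Cayley => cayley_graph S
  | CayleySum => cayley_sum_graph S
  end.

Definition path2 : multidigraph 'Z_2 := fun x y => (x != y) : nat.

(* Adjacency matrix [A ⊗ B + A ⊗ I + I ⊗ B]. *)
Definition strong_product (T U : finType)
    (Gam : multidigraph T) (Del : multidigraph U) : multidigraph (T * U)%type :=
  fun p q => (Gam p.1 q.1 * Del p.2 q.2 + Gam p.1 q.1 * (p.2 == q.2)
              + (p.1 == q.1) * Del p.2 q.2)%N.

Definition strong_double (T : finType) (Gam : multidigraph T) :
    multidigraph (T * 'Z_2)%type :=
  strong_product Gam path2.

Definition adjmx (C : nzRingType) (T : finType) (Gam : multidigraph T) :
    'M[C]_#|T| :=
  \matrix_(i, j) (Gam (enum_val i) (enum_val j))%:R.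

(* The roots of the characteristic polynomial, repeated according to their
   multiplicities; the order of the list is irrelevant. *)
Definition Spec (C : closedFieldType) (T : finType) (Gam : multidigraph T) :
    seq C :=
  sval (closed_field_poly_normal (char_poly (adjmx C Gam))).

(* The energy is a real number seen in [C]; the order of [C] restricts to the
   usual one on its real elements. *)
Definition energy (C : numClosedFieldType) (T : finType)
    (Gam : multidigraph T) : C :=
  \sum_(l <- Spec C Gam) `|l|.

Definition hypoenergetic (C : numClosedFieldType) (T : finType)
    (Gam : multidigraph T) : Prop :=
  energy C Gam < #|T|%:R.

Definition orderenergetic (C : numClosedFieldType) (T : finType)
    (Gam : multidigraph T) : Prop :=
  energy C Gam = #|T|%:R.

Definition hyperenergetic (C : numClosedFieldType) (T : finType)
    (Gam : multidigraph T) : Prop :=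
  2 * #|T|%:R - 2 < energy C Gam.

(* Position of the vertex [p] when the vertices [(h, 0)] are listed before the
   vertices [(h, 1)]. *)
Definition double_index (T : finType) (p : T * 'Z_2) : 'I_(#|T| + #|T|) :=
  unsplit (if p.2 == 0 then inl (enum_rank p.1) else inr (enum_rank p.1)).

Lemma double_index_bij (T : finType) : bijective (@double_index T).
Proof.
exists (fun i => match split i with
                 | inl a => (enum_val a, 0) | inr b => (enum_val b, 1) end).
  case=> h x; rewrite /double_index /= unsplitK.
  case: eqP => [->|/eqP x0]; rewrite enum_rankK //.
  by congr pair; apply/val_inj; case: x x0 => [[|[|m]] lt2].
move=> i; rewrite -[RHS]splitK; case: (split i) => a;
  by rewrite /double_index /= enum_valK.
Qed.

Lemma adjmx_strong_double (C : nzRingType) (T : finType)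
    (Gam : multidigraph T) (A := adjmx C Gam) :
  adjmx C (strong_double Gam) =
  mxsub (fun i => double_index (enum_val i)) (fun i => double_index (enum_val i))
        (block_mx A (A + 1%:M) (A + 1%:M) A).
Proof.
apply/matrixP=> i j; rewrite [LHS]mxE [RHS]mxE.
case: (enum_val i) => h x; case: (enum_val j) => g y.
rewrite /strong_double /strong_product /path2 /double_index /=.
have d2 (z : 'Z_2) : z = 0 \/ z = 1.
  by case: z => [[|[|m]] lt2]; [left | right |]; try exact: val_inj.
by case: (d2 x) => ->; case: (d2 y) => ->;
  rewrite /= ?block_mxEul ?block_mxEur ?block_mxEdl ?block_mxEdr !mxE
    !enum_rankK ?(inj_eq enum_rank_inj) ?muln1 ?muln0 ?addn0 ?add0n // natrD.
Qed.

(* Main.v *)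
Require Import Defs.
From mathcomp Require Import all_boot all_order all_fingroup all_algebra.
From mathcomp Require Import reals complex.
From mathcomp Require Import ring.

(** Let [A] be the adjacency matrix of a graph [Gam] on [n] vertices.  The
    change of basis [(x, y) |-> (x, x + y)] makes the matrix
    [[A, A + I], [A + I, A]] of the strong double block triangular, with
    diagonal blocks [2 A + I] and [- I].  Hence the spectrum of the double
    consists of [n] times [-1] and of the numbers [2 l + 1], for [l] in the
    spectrum of [Gam] ([Spec_strong_double]), so that the energy of the double
    is [n] plus the sum of the [|2 l + 1|] ([energy_strong_double]).

    The sum of the eigenvalues [l] is the trace of [A], a sum of numbers of
    loops, hence it is nonnegative ([sum_Spec_ge0]).  For a Cayley graph with
    [e] outside [S] this sum is zero; a Cayley sum graph can have loops, and
    only the sign of the sum matters.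

    For (a), the sum of the [|2 l + 1|] is at least the sum of the [2 l + 1],
    which is at least [n].  For (b) and (c), a real spectrum with nonnegative
    sum contains some [l0 >= 0] ([Spec_has_ge0]).  Real numbers satisfy
    [|2 l + 1| >= |l| + l] and [|2 l + 1| >= 2 |l| - 1], and at [l0] the two
    sides differ by [1] and [2] respectively.  Summing the first inequality
    gives more than [n] when the energy of [Gam] is [n]; summing the second
    one gives at least [2 energy Gam - n + 2], which is more than [3 n - 2] when
    the energy of [Gam] is more than [2 n - 2]: the gain of [2] at [l0] is
    exactly what the triangle inequality alone would miss. *)

Set Implicit Arguments.
Unset Strict Implicit.
Unset Printing Implicit Defensive.

Import Order.TTheory GRing.Theory Num.Theory.
Local Open Scope ring_scope.

(** * Characteristic polynomials *)

Lemma det_mxsub_bij (R : comNzRingType) (m n : nat) (f : 'I_m -> 'I_n)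
    (M : 'M[R]_n) : bijective f -> \det (mxsub f f M) = \det M.
Proof.
move=> fbij; have mn : m = n by have := bij_eq_card fbij; rewrite !card_ord.
subst m; have finj := bij_inj fbij.
have -> : mxsub f f M = row_perm (perm finj) (col_perm (perm finj) M).
  by apply/matrixP=> i j; rewrite !mxE !permE.
rewrite row_permE col_permE !det_mulmx !det_perm odd_permV mulrC -mulrA.
by rewrite -signr_addb addbb mulr1.
Qed.

Lemma char_poly_mxsub_bij (R : comNzRingType) (m n : nat) (f : 'I_m -> 'I_n)
    (M : 'M[R]_n) : bijective f -> char_poly (mxsub f f M) = char_poly M.
Proof.
move=> fbij; rewrite /char_poly -[RHS](det_mxsub_bij _ fbij); congr (\det _).
by apply/matrixP=> i j; rewrite !mxE (inj_eq (bij_inj fbij)).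
Qed.

(** Adding the second block column to the first and subtracting the first block
    row from the second makes the matrix block triangular. *)
Lemma det_block_sym (R : comNzRingType) (n : nat) (P Q : 'M[R]_n) :
  \det (block_mx P Q Q P) = \det (P + Q) * \det (P - Q).
Proof.
have E : block_mx 1%:M 0 (- 1%:M) 1%:M *m block_mx P Q Q P
           *m block_mx 1%:M 0 1%:M 1%:M = block_mx (P + Q) Q 0 (P - Q).
  rewrite !mulmx_block !(mul1mx, mulmx1, mul0mx, mulmx0, mulNmx) !(add0r, addr0).
  by congr block_mx; rewrite 1?[RHS]addrC // addrA addrK addNr.
have := congr1 determinant E.
by rewrite det_ublock !det_mulmx !det_lblock !det1 !(mul1r, mulr1).
Qed.

Lemma char_poly_affine (F : numFieldType) (n : nat) (A : 'M[F]_n) (s : seq F) :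
    char_poly A = \prod_(l <- s) ('X - l%:P) ->
  char_poly (A + A + 1%:M) = \prod_(l <- s) ('X - (2 * l + 1)%:P).
Proof.
move=> As.
have szs : size s = n.
  by have := size_char_poly A; rewrite As size_prod_XsubC => -[].
(* The characteristic polynomial of [2 A + 1] is that of [A] evaluated at
   [q = (X - 1) / 2], up to the factor [2 ^ n]. *)
pose q : {poly F} := 2^-1 *: ('X - 1%:P).
have q2 : 2%:P * q = 'X - 1%:P.
  by rewrite /q mul_polyC scalerA divff ?scale1r ?pnatr_eq0.
have -> : char_poly (A + A + 1%:M) = 2%:P ^+ n * (char_poly A \Po q).
  rewrite /char_poly -(det_map_mx (comp_poly q)) -detZ; congr (\det _).
  apply/matrixP=> i j; rewrite !mxE /= comp_polyB comp_polyC.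
  rewrite (raddfMn (comp_poly q)) /= comp_polyX.
  by rewrite mulrBr mulrnAr q2 !polyCD polyCMn mulrnBl; ring.
rewrite As rmorph_prod /= -szs.
elim: s {As szs} => [|l s IH]; first by rewrite !big_nil mulr1.
rewrite !big_cons /= exprS mulrACA IH; congr (_ * _).
by rewrite comp_polyB comp_polyX comp_polyC mulrBr q2 (polyCD (2 * l)) polyCM; ring.
Qed.

(** * Spectrum and energy of a strong double *)

Section StrongDouble.

Variables (C : numClosedFieldType) (T : finType) (Gam : multidigraph T).

Lemma char_poly_Spec (U : finType) (Del : multidigraph U) :
  char_poly (adjmx C Del) = \prod_(l <- Spec C Del) ('X - l%:P).
Proof.
rewrite /Spec; case: closed_field_poly_normal => s /= {1}->.
by rewrite (monicP (char_poly_monic _)) scale1r.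
Qed.

Lemma size_Spec : size (Spec C Gam) = #|T|.
Proof.
have := size_char_poly (adjmx C Gam).
by rewrite char_poly_Spec size_prod_XsubC => -[].
Qed.

Lemma Spec_strong_double :
  perm_eq (Spec C (strong_double Gam))
          ([seq 2 * l + 1 | l <- Spec C Gam] ++ nseq #|T| (-1)).
Proof.
apply: prod_XsubC_eq; rewrite -char_poly_Spec adjmx_strong_double.
rewrite char_poly_mxsub_bij; last first.
  exact: bij_comp (double_index_bij T) (enum_val_bij _).
rewrite [LHS]/char_poly.
rewrite big_cat big_map big_nseq /=; set A := adjmx C Gam.
rewrite -(char_poly_affine (char_poly_Spec Gam)) -/A.
have -> : char_poly_mx (block_mx A (A + 1%:M) (A + 1%:M) A) =
    block_mx (char_poly_mx A) (- map_mx polyC (A + 1%:M))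
             (- map_mx polyC (A + 1%:M)) (char_poly_mx A).
  by rewrite /char_poly_mx map_block_mx (scalar_mx_block _ _ 'X) opp_block_mx
             add_block_mx !add0r.
rewrite det_block_sym iter_mulr_1 -det_scalar; congr (_ * _).
  rewrite /char_poly; congr (\det _); apply/matrixP=> i j.
  by rewrite !mxE !polyCD; ring.
congr (\det _); apply/matrixP=> i j.
by rewrite !mxE polyCN !polyCD polyCMn mulrnBl; ring.
Qed.

Lemma energy_strong_double :
  energy C (strong_double Gam) = \sum_(l <- Spec C Gam) `|2 * l + 1| + #|T|%:R.
Proof.
rewrite /energy (perm_big _ Spec_strong_double) big_cat big_map big_nseq /=.
by rewrite normrN1 -Monoid.iteropE.
Qed.

Lemma card_strong_double : #|{: T * 'Z_2}|%:R = #|T|%:R + #|T|%:R :> C.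
Proof. by rewrite card_prod card_ord natrM mulr_natr mulr2n. Qed.

Lemma sum1_Spec : \sum_(l <- Spec C Gam) 1 = #|T|%:R :> C.
Proof. by rewrite big_const_seq count_predT size_Spec -Monoid.iteropE. Qed.

(** The eigenvalues add up to the trace, which counts the loops. *)
Lemma sum_Spec_ge0 : (0 < #|T|)%N -> 0 <= \sum_(l <- Spec C Gam) l.
Proof.
move=> T_gt0; have := char_poly_trace (adjmx C Gam) T_gt0.
rewrite char_poly_Spec -{1}size_Spec coefPn_prod_XsubC; last first.
  by rewrite size_Spec -lt0n.
by move/oppr_inj->; apply: sumr_ge0 => i _; rewrite mxE ler0n.
Qed.

Lemma strong_double_not_hypoenergetic :
  (0 < #|T|)%N -> ~ hypoenergetic C (strong_double Gam).
Proof.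
move=> T_gt0; rewrite /hypoenergetic energy_strong_double card_strong_double.
rewrite ltrD2r => lt; have := le_lt_trans (ler_norm_sum _ _ _) lt.
have sge0 := sum_Spec_ge0 T_gt0.
rewrite big_split /= -mulr_sumr sum1_Spec ger0_norm; last first.
  by rewrite addr_ge0 ?mulr_ge0.
by rewrite gtrDr (le_gtF (mulr_ge0 _ sge0)).
Qed.

Hypothesis T_gt0 : (0 < #|T|)%N.
Hypothesis Spec_real : {in Spec C Gam, forall l, l \is Num.real}.

Lemma Spec_has_ge0 : exists2 l, l \in Spec C Gam & 0 <= l.
Proof.
apply/hasP; apply: contraT => /hasPn noge0.
suff: \sum_(l <- Spec C Gam) l < 0 by rewrite (le_gtF (sum_Spec_ge0 T_gt0)).
have lt0 l : l \in Spec C Gam -> l < 0.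
  by move=> ls; rewrite real_ltNge ?real0 ?Spec_real ?noge0.
have: (0 < size (Spec C Gam))%N by rewrite size_Spec.
case: (Spec C Gam) lt0 => // l s lt0 _; rewrite big_cons.
rewrite ltr_wnDr ?lt0 ?mem_head // big_seq sumr_le0 // => x xs.
by rewrite ltW // lt0 // in_cons xs orbT.
Qed.

(** The gain [d] of the pointwise inequality at nonnegative eigenvalues is
    kept once in the sum, since there is such an eigenvalue. *)
Lemma sum_Spec_gain (f g : C -> C) (d : C) :
    {in Spec C Gam, forall l, f l <= g l} ->
    (forall l, 0 <= l -> f l + d <= g l) ->
  \sum_(l <- Spec C Gam) f l + d <= \sum_(l <- Spec C Gam) g l.
Proof.
move=> fg fdg; have [l ls l_ge0] := Spec_has_ge0.
rewrite !(big_rem l ls) /= addrAC lerD ?fdg // big_seq [leRHS]big_seq.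
by apply: ler_sum => x /mem_rem /fg.
Qed.

Lemma strong_double_not_orderenergetic :
  orderenergetic C Gam -> ~ orderenergetic C (strong_double Gam).
Proof.
rewrite /orderenergetic energy_strong_double card_strong_double.
move=> En /addIr En2.
have: \sum_(l <- Spec C Gam) (`|l| + l) + 1
      <= \sum_(l <- Spec C Gam) `|2 * l + 1|.
  apply: sum_Spec_gain => [l /Spec_real lr|l l_ge0]; last first.
    by rewrite !ger0_norm ?addr_ge0 ?mulr_ge0 // mulr_natl mulr2n.
  case: (real_ge0P lr) => [l_ge0|_]; last by rewrite addNr.
  by rewrite ger0_norm ?addr_ge0 ?mulr_ge0 // mulr_natl mulr2n lerDl.
rewrite big_split /= -/(energy C Gam) En En2 -addrA gerDl.
by rewrite lt_geF // ltr_wpDl // sum_Spec_ge0.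
Qed.

Lemma strong_double_hyperenergetic :
  hyperenergetic C Gam -> hyperenergetic C (strong_double Gam).
Proof.
rewrite /hyperenergetic energy_strong_double card_strong_double => En.
have le : 2 * energy C Gam - #|T|%:R + 2
          <= \sum_(l <- Spec C Gam) `|2 * l + 1|.
  rewrite /energy mulr_sumr -sum1_Spec -sumrB; apply: sum_Spec_gain => l.
    by move=> _; rewrite -{1}[2](@normr_nat C) -normrM -{2}(@normr1 C) lerB_normD.
  by move=> l_ge0; rewrite !ger0_norm ?addr_ge0 ?mulr_ge0 // -addrA lerD2l
                           addrC -[2]/(1 + 1) addrK.
rewrite -ltrBlDr; apply: lt_le_trans le; rewrite -subr_gt0.
have: 0 < 2 * (energy C Gam - (2 * #|T|%:R - 2)) by rewrite mulr_gt0 ?subr_gt0.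
by congr (_ < _); ring.
Qed.

End StrongDouble.

Theorem proposition5p8 (R : realType) (gT : finGroupType) (S : {set gT})
    (k : cayley_kind)
    (heS : (1%g : gT) \notin S)
    (hreal : forall l, l \in Spec R[i] (cayley_star k S) -> l \is Num.real) :
  [/\ ~ hypoenergetic R[i] (strong_double (cayley_star k S)),
      orderenergetic R[i] (cayley_star k S) ->
        ~ orderenergetic R[i] (strong_double (cayley_star k S)) &
      hyperenergetic R[i] (cayley_star k S) ->
        hyperenergetic R[i] (strong_double (cayley_star k S))].
Proof.
have gT_gt0 : (0 < #|gT|)%N by apply/card_gt0P; exists 1%g.
split; first exact: strong_double_not_hypoenergetic.
  exact: strong_double_not_orderenergetic.
exact: strong_double_hyperenergetic.
Qed.
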